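(* For every nonnegative integer $m$, $$\sum_{k=0}^{m} \frac{(-2)^k \binom{m}{k} H_k}{k+1} = \begin{cases} -\dfrac{2}{m+1}\, O_{\frac{m+1}{2}} & \text{if } m \text{ is odd}, \\[2mm] 0 & \text{if } m \text{ is even}. \end{cases}$$
   Context: $H_k = 1 + \frac{1}{2} + \cdots + \frac{1}{k}$ denotes the $k$-th harmonic number (with $H_0 = 0$), and $O_r = 1 + \frac{1}{3} + \cdots + \frac{1}{2r-1}$ denotes the $r$-th odd harmonic number (with $O_0=0$). *)

(* Defs.v *)
From mathcomp Require Import all_boot all_order all_algebra.
Import Order.TTheory GRing.Theory Num.Theory.
Local Open Scope ring_scope.

Definition harmonic (k : nat) : rat := \sum_(1 <= j < k.+1) j%:R^-1.

Definition odd_harmonic (r : nat) : rat :=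
  \sum_(1 <= j < r.+1) (2 * j%:R - 1)^-1.

(* Main.v *)
Require Import Defs.
From mathcomp Require Import all_boot all_order all_algebra.
From mathcomp Require Import ring.
Import Order.TTheory GRing.Theory Num.Theory.
Local Open Scope ring_scope.

(** Absorption, ['C(m, k) / (k + 1) = 'C(m + 1, k + 1) / (m + 1)], turns the
    sum into [A (m + 1) / (m + 1)], where [A n] is the sum of
    [x ^ k * 'C(n, k + 1) * H_k] over [k] ([shifted_transform]) at [x = -2].
    Pascal's rule shows that the first difference of [A] is the binomial
    transform [B] of [x ^ k * H_k] ([binomial_transform]), and, applied
    once more together with [H_(k + 1) = H_k + 1 / (k + 1)], that
    [B (n + 1) = (1 + x) * B n + ((1 + x) ^ (n + 1) - 1) / (n + 1)].
    The value [x = -2] is special because [1 + x = -1]: the recurrence then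
    evaluates [B (n + 1) + B n = A (n + 2) - A n], which is [0] for odd [n] and
    [- 2 / (n + 1)] for even [n].  So [A] keeps its initial value [0] along the
    odd integers, and along the even ones it accumulates the terms of [-2]
    times the odd harmonic number. *)

Lemma harmonicS (k : nat) : harmonic k.+1 = harmonic k + k.+1%:R^-1.
Proof. by rewrite /harmonic big_nat_recr. Qed.

Lemma odd_harmonicS (r : nat) :
  odd_harmonic r.+1 = odd_harmonic r + (r.*2.+1%:R)^-1.
Proof.
rewrite /odd_harmonic big_nat_recr //=; congr (_ + _^-1).
by rewrite -[r.*2]mul2n -[in LHS]natr1 -[in RHS]natr1 natrM; ring.
Qed.

Lemma bin_absorb (n k : nat) :
  'C(n, k)%:R / k.+1%:R = 'C(n.+1, k.+1)%:R / n.+1%:R :> rat.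
Proof.
have hk : k.+1%:R != 0 :> rat by rewrite pnatr_eq0.
have hn : n.+1%:R != 0 :> rat by rewrite pnatr_eq0.
by apply/eqP; rewrite eqr_div // -!natrM mulnC mul_bin_diag mulnC.
Qed.

Definition shifted_transform (x : rat) (n : nat) : rat :=
  \sum_(k < n) x ^+ k * 'C(n, k.+1)%:R * harmonic k.

Definition binomial_transform (x : rat) (n : nat) : rat :=
  \sum_(k < n.+1) x ^+ k * 'C(n, k)%:R * harmonic k.

Lemma shifted_transformS (x : rat) (n : nat) :
  shifted_transform x n.+1 = shifted_transform x n + binomial_transform x n.
Proof.
have -> : shifted_transform x n =
    \sum_(k < n.+1) x ^+ k * 'C(n, k.+1)%:R * harmonic k.
  by rewrite big_ord_recr /= bin_small // mulr0 mul0r addr0.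
rewrite -big_split /=; apply: eq_bigr => k _.
by rewrite binS natrD; ring.
Qed.

Lemma sum_bin_over_succ (x : rat) (n : nat) :
  \sum_(k < n.+1) x ^+ k.+1 * 'C(n, k)%:R / k.+1%:R =
  ((1 + x) ^+ n.+1 - 1) / n.+1%:R.
Proof.
rewrite exprDn [in RHS]big_ord_recl expr1n mul1r expr0 bin0 addrAC subrr add0r.
rewrite mulr_suml; apply: eq_bigr => k _.
by rewrite -mulrA bin_absorb mulrA expr1n mul1r mulr_natr.
Qed.

(** The index shift in the second half of Pascal's rule produces the factor
    [x], and replacing [H_(k + 1)] by [H_k] there leaves the elementary sum of
    [sum_bin_over_succ]. *)
Lemma binomial_transformS (x : rat) (n : nat) :
  binomial_transform x n.+1 =
  (1 + x) * binomial_transform x n + ((1 + x) ^+ n.+1 - 1) / n.+1%:R.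
Proof.
have harm0 : harmonic 0 = 0 by rewrite /harmonic big_geq.
(* The shift of the index is free: [H_0 = 0] removes the bottom term and
   ['C(n, n + 1) = 0] the top one. *)
have low : binomial_transform x n =
    \sum_(k < n.+1) x ^+ k.+1 * 'C(n, k.+1)%:R * harmonic k.+1.
  rewrite /binomial_transform big_ord_recl /= harm0 mulr0 add0r.
  by rewrite [RHS]big_ord_recr /= bin_small // mulr0 mul0r addr0.
rewrite -sum_bin_over_succ mulrDl mul1r {1}low mulr_sumr -!big_split /=.
rewrite /binomial_transform big_ord_recl /= harm0 mulr0 add0r.
apply: eq_bigr => k _.
by rewrite binS natrD harmonicS exprS; ring.
Qed.

Lemma shifted_transformSS (n : nat) :
  shifted_transform (-2) n.+2 =
  shifted_transform (-2) n - (if odd n then 0 else 2 / n.+1%:R).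
Proof.
rewrite !shifted_transformS binomial_transformS.
have -> : 1 + -2 = -1 :> rat by [].
by rewrite -signr_odd /=; case: (odd n) => /=; ring.
Qed.

Lemma shifted_transform_parity (r : nat) :
  shifted_transform (-2) r.*2 = -2 * odd_harmonic r /\
  shifted_transform (-2) r.*2.+1 = 0.
Proof.
elim: r => [|r [IHe IHo]].
  rewrite /shifted_transform /odd_harmonic /harmonic big_ord0 big_geq //.
  by rewrite big_ord_recr big_ord0 /= big_geq // !mulr0.
rewrite doubleS !shifted_transformSS IHe IHo /= odd_double subr0.
by rewrite odd_harmonicS; split=> //; ring.
Qed.

Theorem corollary1 (m : nat) :
  \sum_(0 <= k < m.+1) ((-2) ^+ k * 'C(m, k)%:R * harmonic k / k.+1%:R : rat) =
  if odd m then - (2 / m.+1%:R) * odd_harmonic m.+1./2 else 0.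
Proof.
have -> : \sum_(0 <= k < m.+1)
    ((-2) ^+ k * 'C(m, k)%:R * harmonic k / k.+1%:R : rat) =
    shifted_transform (-2) m.+1 / m.+1%:R.
  rewrite big_mkord mulr_suml; apply: eq_bigr => k _.
  by rewrite mulrAC -[_ * _ / _]mulrA bin_absorb; ring.
have [even_case odd_case] := shifted_transform_parity m.+1./2.
have := odd_double_half m.+1; rewrite oddS.
case: (odd m) => /= def_m.
  by rewrite add0n in def_m; rewrite -{1}def_m even_case; ring.
by rewrite add1n in def_m; rewrite -{1}def_m odd_case mul0r.
Qed.
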